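(* Let $\Lambda$ be a nonvoid subset of $\mathbb N$, $\Theta=\Lambda^{\mathbb N\setminus\{0\}}$ and $\mathcal X=\bigcup_{j\ge1}\Lambda^j$; for $\theta\in\Theta$ let $P_\theta=\sum_{j\ge1}2^{-j}\delta_{(\theta_1,\dots,\theta_j)}$ and let $s_\theta$ be its density with respect to the counting measure on $\mathcal X$. Let $X_1,\dots,X_n$ be i.i.d. with distribution $P_\theta$, and let $\widehat\Theta\subset\Theta$ be the set of all infinite sequences extending $X_{i_0}$, where $X_{i_0}$ is an observation of maximal length among $X_1,\dots,X_n$. Then for all $\theta\in\Theta$ and any choice of a maximum likelihood estimator $\widehat\theta$ in $\widehat\Theta$, $s_{\widehat\theta}$ is a $\rho$-estimator of $s_\theta$ (built from $S$), $P_\theta$-a.s.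
   Context: For $x\in\mathcal X$, its length $\ell(x)$ is the $j$ with $x\in\Lambda^j$. For $j\ge1$, $\pi_j(\theta)=(\theta_1,\dots,\theta_j)$, and $\pi_{-1}:\mathcal X\to\Theta$ is a fixed map with $\pi_{\ell(x)}(\pi_{-1}(x))=x$ for all $x\in\mathcal X$. $S=\{s_\theta:\theta\in\pi_{-1}(\mathcal X)\}$, a countable subset of $\overline S=\{s_\theta:\theta\in\Theta\}$. With $k=\ell(X_{i_0})=\sup_{1\le i\le n}\ell(X_i)$, $\widehat\Theta=\pi_k^{-1}(\{X_{i_0}\})$; the likelihood is maximal at the elements of $\widehat\Theta$, $P_\theta$-a.s. $\rho$-estimators. $n\ge3$, $\boldsymbol X=(X_1,\dots,X_n)$, $h^2(t,t')=\frac12\sum_{x\in\mathcal X}(\sqrt{t(x)}-\sqrt{t'(x)})^2$, $\rho(t,t')=\sum_x\sqrt{t(x)t'(x)}$, $\psi(u)=\frac{u-1}{\sqrt{1+u^2}}$ for $u\in[0,+\infty)$, $\psi(+\infty)=1$, $\kappa=357$; conventions $0/0=1$, $x/0=+\infty$ for $x>0$. For densities $t,t'$ and $r=(t+t')/2$, $\mathbf T(\boldsymbol X,t,t')=\frac n2[\rho(t',r)-\rho(t,r)]+\frac1{\sqrt2}\sum_{i=1}^n\psi(\sqrt{t'/t}(X_i))$; $\boldsymbol\Upsilon(S,t)=\sup_{t'\in S}\mathbf T(\boldsymbol X,t,t')$; $\mathcal E(\boldsymbol X,S)=\{t\in S:\boldsymbol\Upsilon(S,t)\le\inf_{u\in S}\boldsymbol\Upsilon(S,u)+\kappa/10\}$.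 A $\rho$-estimator built from $S$ is any element of the closure $\mathrm{Cl}(\mathcal E(\boldsymbol X,S))$ of $\mathcal E(\boldsymbol X,S)$ with respect to $h$ (chosen measurably). *)

(* Defs.v *)
From HB Require Import structures.
From mathcomp Require Import all_boot all_order all_algebra.
From mathcomp Require Import all_classical all_reals all_analysis.

Set Implicit Arguments.
Unset Strict Implicit.
Unset Printing Implicit Defensive.
Import Order.TTheory GRing.Theory Num.Theory.

Local Open Scope classical_set_scope.
Local Open Scope ring_scope.

(* Sequences are indexed from 0: the coordinate theta_(i+1) is [theta i]. *)
Definition Theta (Lambda : set nat) : Type := nat -> Lambda.

(* The union of the Lambda^j, j >= 1, as the nonempty words over Lambda.  The
   non-emptiness of Lambda is a parameter because a measurableType is pointed. *)
Definition Obs (Lambda : set nat) (hL : Lambda !=set0) : Type :=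
  {x : seq Lambda | (0 < size x)%N}.

Definition len (Lambda : set nat) (hL : Lambda !=set0) (x : Obs hL) : nat :=
  size (val x).

Definition initial_seg (Lambda : set nat) (j : nat) (theta : Theta Lambda) :
  seq Lambda := mkseq theta j.

Lemma size_initialS (Lambda : set nat) (j : nat) (theta : Theta Lambda) :
  (0 < size (initial_seg j.+1 theta))%N.
Proof. by rewrite size_mkseq. Qed.

(* (theta_1, ..., theta_(j+1)) *)
Definition initialS (Lambda : set nat) (hL : Lambda !=set0) (j : nat)
    (theta : Theta Lambda) : Obs hL :=
  exist (fun x : seq Lambda => (0 < size x)%N) (initial_seg j.+1 theta)
    (size_initialS j theta).

Definition point_letter (Lambda : set nat) (hL : Lambda !=set0) : Lambda :=
  let c := cid hL in exist (fun x => x \in Lambda) (projT1 c) (mem_set (projT2 c)).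

HB.instance Definition _ (Lambda : set nat) (hL : Lambda !=set0) :=
  Choice.on (Obs hL).
HB.instance Definition _ (Lambda : set nat) (hL : Lambda !=set0) :=
  isPointed.Build (Obs hL) (initialS hL 0 (fun=> point_letter hL)).
HB.instance Definition _ (Lambda : set nat) (hL : Lambda !=set0) :=
  @isMeasurable.Build default_measure_display (Obs hL) discrete_measurable
    discrete_measurable0 discrete_measurableC discrete_measurableU.

Definition weight (R : realType) (j : nat) : {nonneg R} := (2^-1 ^+ j)%:nng.

Definition Ptheta (R : realType) (Lambda : set nat) (hL : Lambda !=set0)
    (theta : Theta Lambda) : set (Obs hL) -> \bar R :=
  mseries (fun j => mscale (weight R j.+1) \d_(initialS hL j theta)) 0.
Arguments Ptheta R {Lambda} hL theta.

Section Ptheta_probability.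
Context (R : realType) (Lambda : set nat) (hL : Lambda !=set0).
Variable theta : Theta Lambda.

HB.instance Definition _ := Measure.on (Ptheta R hL theta).

Let Ptheta_setT : Ptheta R hL theta setT = 1%E.
Proof.
rewrite /Ptheta /mseries.
have := @cvg_geometric_eseries_half R 1 0.
rewrite expr0 divr1 => /cvg_lim <-//.
congr (lim (_ @ \oo)); apply/funext => m; rewrite /eseries/=.
apply: eq_bigr => j _.
have -> : mscale (weight R j.+1) \d_(initialS hL j theta) setT =
  ((2^-1 ^+ j.+1)%:E * \d_(initialS hL j theta) setT)%E by [].
rewrite diracT mule1.
by rewrite addn1 exprVn natrX mul1r.
Qed.

HB.instance Definition _ := Measure_isProbability.Build _ _ _
  (Ptheta R hL theta) Ptheta_setT.

End Ptheta_probability.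

(* The density with respect to the counting measure: its value at x is the mass
   of {x}; see [Ptheta_dens] and [densE]. *)
Definition dens (R : realType) (Lambda : set nat) (hL : Lambda !=set0)
    (theta : Theta Lambda) (x : Obs hL) : R :=
  fine (Ptheta R hL theta [set x]).
Arguments dens R {Lambda hL} theta x.

Lemma PthetaE (R : realType) (Lambda : set nat) (hL : Lambda !=set0)
    (theta : Theta Lambda) (A : set (Obs hL)) :
  Ptheta R hL theta A =
  (\sum_(0 <= j <oo) (2^-1 ^+ j.+1 * (initialS hL j theta \in A)%:R)%:E)%E.
Proof.
by rewrite /Ptheta /mseries; congr (lim (_ @ \oo)).
Qed.

Lemma len_initialS (Lambda : set nat) (hL : Lambda !=set0) (j : nat)
    (theta : Theta Lambda) : len (initialS hL j theta) = j.+1.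
Proof. exact: size_mkseq. Qed.

Lemma initialS_inj (Lambda : set nat) (hL : Lambda !=set0) (theta : Theta Lambda) :
  injective (initialS hL ^~ theta).
Proof.
by move=> i j /(congr1 (@len _ _)); rewrite !len_initialS => -[].
Qed.

Lemma dens_initialS (R : realType) (Lambda : set nat) (hL : Lambda !=set0)
    (theta : Theta Lambda) (j : nat) :
  dens R theta (initialS hL j theta) = 2^-1 ^+ j.+1.
Proof.
have dens_ge0 (k : nat) : true ->
    (0 <= (2^-1 ^+ k.+1 *
           (initialS hL k theta \in [set initialS hL j theta])%:R : R)%:E)%E.
  by move=> _; rewrite lee_fin mulr_ge0.
rewrite /dens PthetaE (nneseriesD1 dens_ge0 (n := j)) //.
rewrite in_set1 eqxx mulr1 eseries0 ?adde0//.
move=> k _ /= kj; rewrite in_set1 (inj_eq (@initialS_inj _ _ _)).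
by rewrite (negbTE kj) mulr0.
Qed.

Lemma densE (R : realType) (Lambda : set nat) (hL : Lambda !=set0)
    (theta : Theta Lambda) (x : Obs hL) :
  dens R theta x =
  if initial_seg (len x) theta == val x then 2^-1 ^+ len x else 0.
Proof.
case: eqP => [xE|xE].
  have lx : (0 < len x)%N := valP x.
  have -> : x = initialS hL (len x).-1 theta.
    by apply/val_inj; rewrite /= prednK.
  by rewrite dens_initialS len_initialS.
rewrite /dens PthetaE eseries0//= => j _ _.
rewrite in_set1 (_ : (_ == x) = false) ?mulr0//; apply/eqP => xj.
by apply: xE; rewrite -xj len_initialS.
Qed.

Lemma Ptheta_dens (R : realType) (Lambda : set nat) (hL : Lambda !=set0)
    (theta : Theta Lambda) (A : set (Obs hL)) :
  Ptheta R hL theta A = (\esum_(x in A) (dens R theta x)%:E)%E.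
Proof.
rewrite PthetaE nneseries_esumT; last by move=> j; rewrite lee_fin mulr_ge0.
have bij : set_bij setT (range (initialS hL ^~ theta)) (initialS hL ^~ theta).
  by split=> // i j _ _; exact: initialS_inj.
transitivity (\esum_(x in range (initialS hL ^~ theta))
    (dens R theta x * (x \in A)%:R)%:E)%E.
  rewrite (reindex_esum _ _ _ _ bij); apply: eq_esum => j _.
  by rewrite dens_initialS.
rewrite esum_mkcond [RHS]esum_mkcond; apply: eq_esum => x _.
case: ifPn => [_|]; first by case: ifPn => _; rewrite ?mulr1 ?mulr0.
rewrite notin_setE /= => nx; case: ifPn => // _.
rewrite densE; case: eqP => // xE; exfalso; apply: nx.
exists (len x).-1 => //; apply/val_inj.
by rewrite /= prednK//; exact: (valP x).
Qed.

Definition likelihood (R : realType) (Lambda : set nat) (hL : Lambda !=set0)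
    (n : nat) (x : 'I_n -> Obs hL) (theta : Theta Lambda) : R :=
  \prod_(i < n) dens R theta (x i).
Arguments likelihood R {Lambda hL n} x theta.

Definition is_MLE (R : realType) (Lambda : set nat) (hL : Lambda !=set0)
    (n : nat) (x : 'I_n -> Obs hL) (theta : Theta Lambda) : Prop :=
  forall theta' : Theta Lambda, likelihood R x theta' <= likelihood R x theta.
Arguments is_MLE R {Lambda hL n} x theta.

Definition extensions (Lambda : set nat) (hL : Lambda !=set0) (x : Obs hL) :
  set (Theta Lambda) := initial_seg (len x) @^-1` [set val x].

(* For every data set, the extensions of a longest observation maximize the
   likelihood over the whole of Theta. *)
Lemma extensions_MLE (R : realType) (Lambda : set nat) (hL : Lambda !=set0)
    (n : nat) (x : 'I_n -> Obs hL) (i0 : 'I_n) (theta : Theta Lambda) :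
    (forall i, (len (x i) <= len (x i0))%N) -> extensions (x i0) theta ->
  is_MLE R x theta.
Proof.
rewrite /extensions /= => i0max theta_ext theta'.
have dens_ge0 t y : 0 <= dens R t y :> R.
  by rewrite densE; case: ifP => // _; rewrite exprn_ge0.
case: (boolP [forall i, initial_seg (len (x i)) theta' == val (x i)]); last first.
  move=> /forallPn[i xi]; rewrite /likelihood (bigD1 i)//= densE (negbTE xi) mul0r.
  by apply: prodr_ge0.
move=> /forallP pre; apply: ler_prod => i _; rewrite dens_ge0 /= !densE pre.
suff -> : initial_seg (len (x i)) theta = val (x i) by rewrite eqxx.
have takeE t : initial_seg (len (x i)) t =
    take (len (x i)) (initial_seg (len (x i0)) t).
  by rewrite /initial_seg /mkseq -map_take take_iota (minn_idPl (i0max i)).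
by rewrite takeE theta_ext -(eqP (pre i0)) -takeE (eqP (pre i)).
Qed.

Section rho_estimation.
Local Open Scope ereal_scope.
Context (R : realType) (T : choiceType).
Implicit Types t u : T -> R.

(* Densities with respect to the counting measure on the countable set T. *)
Definition is_density t : Prop :=
  (forall x, 0 <= t x)%R /\ \esum_(x in [set: T]) (t x)%:E = 1.

Definition hellinger t t' : \bar R :=
  sqrte ((2^-1)%:E *
         \esum_(x in [set: T]) ((Num.sqrt (t x) - Num.sqrt (t' x)) ^+ 2)%:E).

Definition affinity t t' : \bar R :=
  \esum_(x in [set: T]) (Num.sqrt (t x * t' x))%:E.

(* The quotient a / b of nonnegative reals, with 0 / 0 = 1 and a / 0 = +oo
   for a > 0. *)
Definition density_ratio (a b : R) : \bar R :=
  if b == 0%R then (if a == 0%R then 1 else +oo) else (a / b)%:E.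

(* Only used on [0, +oo]; the value at -oo is immaterial. *)
Definition psi (v : \bar R) : R :=
  if v is r%:E then ((r - 1) / Num.sqrt (1 + r ^+ 2))%R else 1%R.

Definition Tstat (n : nat) (x : 'I_n -> T) t t' : \bar R :=
  let r := fun y => ((t y + t' y) / 2)%R in
  (n%:R / 2)%:E * (affinity t' r - affinity t r) +
  ((Num.sqrt 2)^-1 *
   \sum_(i < n) psi (sqrte (density_ratio (t' (x i)) (t (x i)))))%:E.

Definition Upsilon (n : nat) (x : 'I_n -> T) (S : set (T -> R)) t : \bar R :=
  ereal_sup [set Tstat x t t' | t' in S].

Definition kappa : R := 357.

Definition near_minimizers (n : nat) (x : 'I_n -> T) (S : set (T -> R)) :
    set (T -> R) :=
  [set t | S t /\
    Upsilon x S t <= ereal_inf [set Upsilon x S u | u in S] + (kappa / 10)%:E].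

(* The closure in the set of densities, with respect to the Hellinger distance. *)
Definition hellinger_closure (E : set (T -> R)) : set (T -> R) :=
  [set t | is_density t /\
    forall eps : R, (0 < eps)%R -> exists2 u, E u & hellinger t u < eps%:E].

(* When T carries the discrete sigma-algebra, as here, every selection of such
   an element is a measurable function of the data x. *)
Definition is_rho_estimator (n : nat) (x : 'I_n -> T) (S : set (T -> R)) t :
    Prop :=
  hellinger_closure (near_minimizers x S) t.

End rho_estimation.

(* To be used with a map pim1 choosing one sequence extending each word. *)
Definition model (R : realType) (Lambda : set nat) (hL : Lambda !=set0)
    (pim1 : Obs hL -> Theta Lambda) : set (Obs hL -> R) :=
  [set dens R theta | theta in range pim1].
Arguments model R {Lambda hL} pim1.

Definition iid_with_law d (Omega : measurableType d) d' (T : measurableType d')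
    (R : realType) (P : probability Omega R) (n : nat)
    (X : 'I_n -> {RV P >-> T}) (mu : set T -> \bar R) : Prop :=
  (forall A : 'I_n -> set T, (forall i, measurable (A i)) ->
     (P (\bigcap_(i in [set: 'I_n]) X i @^-1` A i) =
      \prod_(i < n) P (X i @^-1` A i))%E) /\
  (forall i (A : set T), measurable A -> distribution P (X i) A = mu A).

(* Main.v *)
Require Import Defs.
From mathcomp Require Import all_boot all_order all_algebra.
From mathcomp Require Import all_classical all_reals all_analysis.
Import Order.TTheory GRing.Theory Num.Theory.
Local Open Scope classical_set_scope.
Local Open Scope ring_scope.

(* Almost surely all the observations are prefixes of theta, hence of any
   extension of the longest one.  For two sequences theta1, theta2 with densities
   t1, t2, the affinities of t1 and t2 with (t1 + t2) / 2 coincide, so that only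
   the psi-part of the statistic T(t1, t2) remains; when theta1 extends all the
   data, t2 / t1 is 0 or 1 at each observation and T(t1, t2) <= 0.  Since
   T(t, t) = 0, Upsilon is nonnegative on S, hence every t in S whose sequence
   extends the data minimizes Upsilon.  These t include densities arbitrarily
   Hellinger-close to that of the maximum likelihood estimator: choose in
   pi_{-1}(X) an extension of a long prefix of it. *)

Section rho_statistic.
Context (R : realType) (T : choiceType).
Implicit Types t u : T -> R.

Lemma psi_density_ratio_le0 (a b : R) :
  0 <= a -> a <= b -> psi (sqrte (density_ratio a b)) <= 0.
Proof.
move=> a0 ab; rewrite /density_ratio; case: eqP => [b0|/eqP b0].
  (* Here the convention 0 / 0 = 1 applies and never the value [+oo], and psi vanishes at 1. *)
  have -> : a = 0 by apply/eqP; rewrite eq_le a0 -b0 ab.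
  by rewrite eqxx /= sqrtr1 subrr mul0r.
have bgt0 : 0 < b by rewrite lt_neqAle eq_sym b0 (le_trans a0 ab).
rewrite /= mulr_le0_ge0 ?invr_ge0 ?sqrtr_ge0// subr_le0 -[leRHS]sqrtr1.
by apply: ler_wsqrtr; rewrite ler_pdivrMr// mul1r.
Qed.

Lemma psi_density_ratio_diag (a : R) : psi (sqrte (density_ratio a a)) = 0.
Proof.
rewrite /density_ratio; case: eqP => [_|/eqP a0]; last rewrite divff//.
all: by rewrite /= sqrtr1 subrr mul0r.
Qed.

Lemma Tstat_diag n (x : 'I_n -> T) t : is_density t -> Tstat x t t = 0%E.
Proof.
move=> [t0 t1]; rewrite /Tstat big1 ?mulr0 ?adde0; last first.
  by move=> i _; exact: psi_density_ratio_diag.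
have -> : affinity t (fun y => (t y + t y) / 2) = 1%E.
  rewrite -t1; apply: eq_esum => y _.
  by rewrite mulrDl -splitr -expr2 sqrtr_sqr ger0_norm.
by rewrite subee ?mule0.
Qed.

Lemma Tstat_le0 n (x : 'I_n -> T) t u :
    let r := fun y => (t y + u y) / 2 in
    affinity u r = affinity t r -> (forall i, 0 <= u (x i) <= t (x i)) ->
  (Tstat x t u <= 0)%E.
Proof.
move=> r rE xtu; rewrite /Tstat rE -[leRHS]adde0 leeD//.
  apply: mule_ge0_le0; first by rewrite lee_fin divr_ge0.
  (* The affinity is an extended real: a difference of equal infinities is [-oo] by convention, so
     the bound by 0 survives. *)
  by case: (affinity t r) => [s||] /=; rewrite ?addeNy ?addNye ?leNye// -EFinD subrr.
rewrite lee_fin mulr_ge0_le0 ?invr_ge0 ?sqrtr_ge0//.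
by apply: sumr_le0 => i _; have /andP[u0 ut] := xtu i; exact: psi_density_ratio_le0.
Qed.

Lemma near_minimizersP n (x : 'I_n -> T) (S : set (T -> R)) t :
    (forall u, S u -> is_density u) -> S t ->
    (forall u, S u -> (Tstat x t u <= 0)%E) ->
  near_minimizers x S t.
Proof.
move=> Sdens St tle0; split=> //; apply: (@le_trans _ _ 0%E).
  by apply: ge_ereal_sup => _ [u Su <-]; exact: tle0.
apply: adde_ge0; last by rewrite lee_fin divr_ge0.
apply: le_ereal_inf_tmp => _ [u Su <-]; apply: ereal_sup_ubound.
by exists u => //; apply: Tstat_diag; exact: Sdens.
Qed.

End rho_statistic.

Section prefix_densities.
Context (R : realType) (Lambda : set nat) (hL : Lambda !=set0).
Implicit Types (theta : Theta Lambda) (x : Obs hL).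

Lemma initial_seg_take theta i j :
  (i <= j)%N -> initial_seg i theta = take i (initial_seg j theta).
Proof.
by move=> ij; rewrite /initial_seg /mkseq -map_take take_iota (minn_idPl ij).
Qed.

Lemma eq_initial_seg theta1 theta2 i j : (i <= j)%N ->
  initial_seg j theta1 = initial_seg j theta2 ->
  initial_seg i theta1 = initial_seg i theta2.
Proof. by move=> ij e; rewrite !(initial_seg_take _ _ _ ij) e. Qed.

Lemma dens_ge0 theta x : 0 <= dens R theta x.
Proof. by rewrite densE; case: ifP. Qed.

Lemma dens_is_density theta : is_density (dens R (hL := hL) theta).
Proof.
split=> [x|]; first exact: dens_ge0.
by rewrite -Ptheta_dens; exact: (@probability_setT _ _ _ (Ptheta R hL theta)).
Qed.

(** Every density is at most [2^-1 ^+ len x] at [x], and a sequence with prefix [x] attains this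
    bound. *)
Lemma dens_le_prefix theta1 theta2 x :
  initial_seg (len x) theta1 = val x -> dens R theta2 x <= dens R theta1 x.
Proof. by move=> xE; rewrite !densE xE eqxx; case: ifP. Qed.

Lemma range_initialSP theta x :
  range (initialS hL ^~ theta) x <-> initial_seg (len x) theta = val x.
Proof.
split=> [[j _ <-]|xE]; first by rewrite len_initialS.
by exists (len x).-1 => //; apply/val_inj; rewrite /= prednK//; exact: (valP x).
Qed.

Lemma esum_initialS theta (g : Obs hL -> \bar R) :
    (forall x, initial_seg (len x) theta <> val x -> g x = 0%E) ->
  (\esum_(x in setT) g x = \esum_(j in setT) g (initialS hL j theta))%E.
Proof.
move=> g0; transitivity (\esum_(x in range (initialS hL ^~ theta)) g x)%E.
  rewrite [RHS]esum_mkcond; apply: eq_esum => x _.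
  case: ifPn => //; rewrite notin_setE => xN; apply: g0 => xE.
  by apply: xN; exact/range_initialSP.
rewrite (reindex_esum setT _ (initialS hL ^~ theta))//.
by split=> // i j _ _; exact: initialS_inj.
Qed.

(** Each density lives on the prefixes of its own sequence, one per length, with a weight depending
    only on the length. At each length the midpoint is the full weight on both prefixes if they
    agree and half of it otherwise, a condition symmetric in the two sequences. *)
Lemma affinity_midpoint theta1 theta2 :
  let r := fun x => (dens R theta1 x + dens R theta2 x) / 2 in
  affinity (dens R theta2) r = affinity (dens R (hL := hL) theta1) r.
Proof.
move=> r; rewrite /affinity (esum_initialS theta2) 1?(esum_initialS theta1).
- apply: eq_esum => j _; rewrite /r !densE !len_initialS /= !eqxx.
  by rewrite [initial_seg _ theta2 == _]eq_sym; case: eqP; rewrite ?(addr0, add0r).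
- by move=> x /eqP/negPf xE; rewrite densE xE mul0r sqrtr0.
- by move=> x /eqP/negPf xE; rewrite densE xE mul0r sqrtr0.
Qed.

Lemma Ptheta_len_gt theta m :
  Ptheta R hL theta [set x | (m < len x)%N] = (2^-1 ^+ m)%:E.
Proof.
(* The word of index [j] has length [j.+1], so [m < j.+1] becomes [m <= j] and a geometric tail is
   left. *)
rewrite PthetaE (eq_eseriesr (g := fun j =>
    if (m <= j)%N then (2^-1 ^+ j.+1)%:E else 0%E)); last first.
  move=> j _; case: ifPn => mj.
    by rewrite mem_set ?mulr1//= len_initialS.
  by rewrite memNset ?mulr0//= len_initialS ltnS; exact/negP.
rewrite -eseries_mkcond -[LHS](eseries_cond _ xpredT) /=.
rewrite -(nneseries_addn m (f := fun j => (2^-1 ^+ j.+1)%:E)); last first.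
  by move=> j; rewrite lee_fin.
have := @cvg_geometric_eseries_half R 1 m.
rewrite mul1r -exprVn => /cvg_lim <-//.
congr (lim (_ @ \oo)); apply/funext => k; apply: eq_bigr => j _.
by rewrite mul1r addnS natrX exprVn.
Qed.

Lemma sqr_sqrtB_le (a b : R) : 0 <= a -> 0 <= b ->
  (Num.sqrt a - Num.sqrt b) ^+ 2 <= a + b.
Proof.
move=> a0 b0; rewrite sqrrB !sqr_sqrtr// -addrAC lerBlDr lerDl.
by rewrite mulrn_wge0// mulr_ge0 ?sqrtr_ge0.
Qed.

(** The densities agree on words of length at most [m], so only the two tails, of mass [2^-1 ^+ m]
    each, contribute; the factor 1/2 averages them. *)
Lemma hellinger_prefix theta1 theta2 m :
    initial_seg m theta1 = initial_seg m theta2 ->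
  (hellinger (dens R (hL := hL) theta1) (dens R theta2) <=
    sqrte (2^-1 ^+ m)%:E)%E.
Proof.
move=> e12; rewrite /hellinger lee_sqrt ?lee_fin//.
rewrite (_ : (2^-1 ^+ m)%:E =
   (2^-1)%:E * ((2^-1 ^+ m)%:E + (2^-1 ^+ m)%:E) :> \bar R)%E; last first.
  by rewrite -EFinD -EFinM mulrDr ![2^-1 * _]mulrC -splitr.
rewrite lee_pmul2l ?lte_fin ?invr_gt0//.
rewrite -{1}(Ptheta_len_gt theta1) -(Ptheta_len_gt theta2) !Ptheta_dens -esumD//;
  try by move=> x _; rewrite lee_fin dens_ge0.
rewrite [leRHS]esum_mkcond; apply: le_esum => x _.
case: ifPn => [_|]; first by rewrite lee_fin sqr_sqrtB_le ?dens_ge0.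
rewrite notin_setE /= => /negP; rewrite -leqNgt => xm.
by rewrite !densE (eq_initial_seg _ _ _ _ xm e12) subrr expr0n.
Qed.

Lemma hellinger_closure_prefixes (E : set (Obs hL -> R)) theta k :
    (forall j, (k <= j)%N -> exists2 theta',
      initial_seg j theta' = initial_seg j theta & E (dens R theta')) ->
  hellinger_closure E (dens R theta).
Proof.
move=> kE; split=> [|eps eps0]; first exact: dens_is_density.
(* The distance bound is the square root of [2^-1 ^+ m], hence the threshold [eps ^+ 2]. *)
have [m _ mP] := near_infty_natSinv_expn_lt (PosNum (exprn_gt0 2 eps0)).
have [theta' e' E'] := kE (maxn k m) (leq_maxl _ _).
exists (dens R theta') => //.
apply: le_lt_trans (hellinger_prefix _ _ _ (esym e')) _.
rewrite /= lte_fin -[ltRHS]ger0_norm ?ltW// -sqrtr_sqr ltr_sqrt ?exprn_gt0//.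
by rewrite exprVn -div1r; apply: (mP _ (leq_maxr k m)).
Qed.

(** The words that are not prefixes of [theta] have density 0, and finitely many null events have a
    null union. *)
Lemma ae_prefix d (Omega : measurableType d) (P : probability Omega R) n
    (X : 'I_n -> {RV P >-> Obs hL}) theta :
    iid_with_law X (Ptheta R hL theta) ->
  {ae P, forall w, forall i, initial_seg (len (X i w)) theta = val (X i w)}.
Proof.
move=> [_ law]; apply: filter_forall => i.
pose N := [set x : Obs hL | initial_seg (len x) theta <> val x].
apply: (@negligibleS _ _ _ _ (X i @^-1` N)) => //; apply/negligibleP.
  by rewrite -[X in measurable X]setTI; exact: measurable_funPT.
rewrite -[LHS]/(distribution P (X i) N) law// Ptheta_dens esum1// => x Nx.
by rewrite densE; case: eqP.
Qed.

End prefix_densities.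

Theorem proposition29 (R : realType) (Lambda : set nat) (hL : Lambda !=set0)
    (pim1 : Obs hL -> Theta Lambda)
    (hpim1 : forall x : Obs hL, initial_seg (len x) (pim1 x) = val x)
    (n : nat) (hn : (3 <= n)%N)
    (i0 : ('I_n -> Obs hL) -> 'I_n)
    (hi0 : forall (x : 'I_n -> Obs hL) (i : 'I_n),
       (len (x i) <= len (x (i0 x)))%N)
    (thetahat : ('I_n -> Obs hL) -> Theta Lambda)
    (thetahat_in : forall x : 'I_n -> Obs hL,
       extensions (x (i0 x)) (thetahat x))
    (thetahat_MLE : forall x : 'I_n -> Obs hL, is_MLE R x (thetahat x))
    (theta : Theta Lambda)
    (d : measure_display) (Omega : measurableType d) (P : probability Omega R)
    (X : 'I_n -> {RV P >-> Obs hL})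
    (hX : iid_with_law X (Ptheta R hL theta)) :
  {ae P, forall w : Omega,
     is_rho_estimator (fun i => X i w) (model R pim1)
       (dens R (thetahat (fun i => X i w)))}.
Proof.
apply: filterS (ae_prefix _ _ _ _ _ _ _ _ _ hX) => w.
set x := (fun i => X i w) => xtheta; set k := len (x (i0 x)).
(* The longest observation is a prefix of both sequences. *)
have hat_k : initial_seg k (thetahat x) = initial_seg k theta.
  by rewrite [LHS](thetahat_in x); exact/esym/xtheta.
apply: (hellinger_closure_prefixes _ _ _ _ _ k) => j kj.
(* [y] has length [j.+1 > k], so [pim1 y] follows [thetahat x] past all the data, while its density
   belongs to the model. *)
set y := initialS hL j (thetahat x).
have pim1_y i : (i <= j.+1)%N ->
    initial_seg i (pim1 y) = initial_seg i (thetahat x).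
  move=> /eq_initial_seg; apply.
  by have := hpim1 y; rewrite len_initialS.
exists (pim1 y); first exact: pim1_y.
have x_prefix i : initial_seg (len (x i)) (pim1 y) = val (x i).
  rewrite pim1_y; last exact: leq_trans (hi0 x i) (leqW kj).
  by rewrite (eq_initial_seg _ _ _ _ _ (hi0 x i) hat_k); exact: xtheta.
apply: near_minimizersP => [_ [theta' _ <-]||_ [theta' _ <-]].
- exact: dens_is_density.
- by exists (pim1 y) => //; exists y.
apply: Tstat_le0 => [|i]; first exact: affinity_midpoint.
by rewrite dens_ge0 dens_le_prefix.
Qed.
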